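(* Let $q\in\mathbb{C}$ with $0<|q|<1$, let $r\in\mathbb{N}$ (that is, $r\ge 1$), let $x\in\mathbb{R}$, let $n\ge 0$ be an integer, and let $a,b\in\mathbb{N}$ with $a\equiv 1\pmod 2$ and $b\equiv 1\pmod 2$. Then \begin{align*} & [2]_{q^{b}}^{r}\sum_{i=0}^{n}\binom{n}{i}[a]_{q}^{n-i}\,[b]_{q}^{i}\,E_{n-i,q^{a}}^{(r)}(bx)\,S_{n,i,q^{b}}^{(r)}(a)\\ ={} & [2]_{q^{a}}^{r}\sum_{i=0}^{n}\binom{n}{i}[b]_{q}^{n-i}\,[a]_{q}^{i}\,E_{n-i,q^{b}}^{(r)}(ax)\,S_{n,i,q^{a}}^{(r)}(b). \end{align*}
   Context: Powers of $q$: fix a logarithm $\log q$ of $q$ and put $q^{y}=\exp(y\log q)$ for $y\in\mathbb{R}$; for $c\in\mathbb{N}$, real powers of $q^{c}$ are understood as $(q^{c})^{y}=q^{cy}$. $q$-numbers: for $c\in\mathbb{N}$ and $y\in\mathbb{R}$, $[y]_{q^{c}}=\frac{1-q^{cy}}{1-q^{c}}$; in particular $[y]_q=\frac{1-q^{y}}{1-q}$ and $[2]_{q^c}=1+q^c$. Higher-order $q$-Euler polynomials: for $c\in\mathbb{N}$ and $y\in\mathbb{R}$, the quantities $E_{n,q^{c}}^{(r)}(y)$, $n\ge 0$, are defined by the generating function $$[2]_{q^{c}}^{r}\sum_{m_{1},\ldots,m_{r}=0}^{\infty}(-q^{c})^{m_{1}+\cdots+m_{r}}\,e^{[m_{1}+\cdots+m_{r}+y]_{q^{c}}\,t}=\sum_{n=0}^{\infty}E_{n,q^{c}}^{(r)}(y)\frac{t^{n}}{n!},$$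 where $(-q^c)^{m}=(-1)^m q^{cm}$. The sums $S$: for $c,d\in\mathbb{N}$ and integers $0\le i\le n$, $$S_{n,i,q^{c}}^{(r)}(d)=\sum_{j_{1},\ldots,j_{r}=0}^{d-1}(-1)^{\sum_{l=1}^{r}j_{l}}\,q^{c\,(n-i+1)\sum_{l=1}^{r}j_{l}}\,[j_{1}+\cdots+j_{r}]_{q^{c}}^{i},$$ with the convention $[0]_{q^c}^{0}=1$. *)

(* Defs.v *)
From HB Require Import structures.
From mathcomp Require Import all_boot all_order all_algebra finmap complex.
From mathcomp Require Import all_classical all_reals all_analysis.
Import Order.TTheory GRing.Theory Num.Theory.
Import numFieldNormedType.Exports.

Set Implicit Arguments.
Unset Strict Implicit.
Unset Printing Implicit Defensive.

Local Open Scope classical_set_scope.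
Local Open Scope ring_scope.
Local Open Scope complex_scope.

Definition expC (R : realType) (z : R[i]) : R[i] :=
  let: u +i* v := z in (expR u)%:C * (cos v +i* sin v).

(* [s] is the unordered sum of the family [f]. *)
Definition has_sum (K : numFieldType) (I : choiceType) (f : I -> K) (s : K)
    : Prop :=
  forall e : K, 0 < e -> exists A : {fset I}, forall B : {fset I},
    (A `<=` B)%fset -> `|s - \sum_(k <- B) f k| < e.

(* The topology on R[i] is only found through an explicit [numFieldType]. *)
Definition series_cvg_to (K : numFieldType) (u : nat -> K) (s : K) : Prop :=
  series u @ \oo --> s.

(* In the definitions below, [lq] stands for the chosen logarithm of [q]
   (expC lq = q). It is needed only for real exponents. *)

Definition qpow (R : realType) (lq : R[i]) (y : R) : R[i] := expC (y%:C * lq).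

(* [y]_{q^c} *)
Definition qnum (R : realType) (q lq : R[i]) (c : nat) (y : R) : R[i] :=
  (1 - qpow lq (c%:R * y)) / (1 - q ^+ c).

(* The exponential generating function of [E] is that of the order-r q-Euler
   polynomials in base q^c, evaluated at [y]; [m] ranges over N^r. *)
Definition qEuler_genfun (R : realType) (q lq : R[i]) (r c : nat) (y : R)
    (E : nat -> R[i]) : Prop :=
  forall t : R[i], exists2 G : R[i],
    has_sum (fun m : {ffun 'I_r -> nat} =>
      (- q ^+ c) ^+ (\sum_(l < r) m l)%N
      * expC (qnum q lq c ((\sum_(l < r) m l)%N%:R + y) * t)) G
    & series_cvg_to (fun n => E n * (t ^+ n / n`!%:R)) (qnum q lq c 2 ^+ r * G).

(* E_{n,q^c}^{(r)}(y): the sequence with the above generating function (the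
   default value 0 is irrelevant when 0 < |q| < 1 and 0 < c). *)
Definition qEuler (R : realType) (q lq : R[i]) (r c : nat) (y : R)
    : nat -> R[i] :=
  xget (fun=> 0) [set E : nat -> R[i] | qEuler_genfun q lq r c y E].

(* S_{n,i,q^c}^{(r)}(d) *)
Definition qS (R : realType) (q lq : R[i]) (r n i c d : nat) : R[i] :=
  \sum_(j : {ffun 'I_r -> 'I_d})
    (-1) ^+ (\sum_(l < r) j l)%N
    * q ^+ (c * (n - i + 1) * \sum_(l < r) j l)%N
    * qnum q lq c (\sum_(l < r) j l)%N%:R ^+ i.

(* Main.v *)
Require Import Defs.
From HB Require Import structures.
From mathcomp Require Import all_boot all_order all_algebra finmap complex.
From mathcomp Require Import all_classical all_reals all_analysis.
From mathcomp Require Import ring summability.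
Import Order.TTheory GRing.Theory Num.Theory.
Import numFieldNormedType.Exports.
Local Open Scope classical_set_scope.
Local Open Scope ring_scope.
Local Open Scope complex_scope.

(** Write [Q = q^c] and [Y = q^(c y)]. Expanding
[[|m| + y]_Q^k = (1 - Q)^(-k) sum_l C(k,l) (-Y)^l Q^(l|m|)] and summing the
geometric family over [m] in N^r gives the closed form (lemma [qEulerE])

  [E_k = (1+Q)^r (1-Q)^(-k) sum_l C(k,l) (-Y)^l (1 + Q^(l+1))^(-r)].

In this form the theorem is a finite identity. Both [[a]_q [M + bx]_(q^a)] and
[[b]_q [J]_(q^b)] have denominator [1 - q], so for fixed [J] the sum over [i]
is the binomial expansion of [(u (1 - X z) + (1 - u))^n = (1 - X u z)^n], with
[u = q^(bJ)], [X = q^(abx)] and [z^l] standing for the weight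
[(1 + q^(a(l+1)))^(-r)]. The remaining alternating geometric sum over
[j] in {0..a-1}^r equals [((1 + q^(ab(l+1))) / (1 + q^(b(l+1))))^r] because
[a] is odd. What results (lemma [binomial_qEuler_sum]) is symmetric in [a]
and [b].

The analytic part is the identification of [qEuler] with this closed form.
Up to the factor [(1+Q)^r], the closed form is the family of moments
[sum_m (-Q)^|m| w_m^k] of the bounded weights [w_m = [|m| + y]_Q]
([has_sum_qEuler_value]). Replacing the exponential
by its Taylor polynomials, with an error that is uniform over the bounded set
of weights ([expC_tail_le]), interchanges the sum over [m] with the exponential
series ([has_sum_expC]), so the moments have the required generating function.
A power series that vanishes identically has zero coefficients
([power_series_eq0]), so no other sequence has it. *)

(** * The finite identity *)

(** Both sides are the coefficient of ['X^l] in
    [(u (1 + 'X) + (1 - u))^n = (1 + u 'X)^n]. *)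
Lemma sum_bin_mul_bin (K : comNzRingType) (n l : nat) (u : K) :
  \sum_(i < n.+1)
     'C(n, i)%:R * u ^+ (n - i) * (1 - u) ^+ i * 'C(n - i, l)%:R
  = 'C(n, l)%:R * u ^+ l.
Proof.
have coef_pow k (c : K) : ((1 + c *: 'X) ^+ k : {poly K})`_l
    = 'C(k, l)%:R * c ^+ l.
  rewrite addrC exprD1n coef_sum.
  under eq_bigr do rewrite coefMn exprZn coefZ coefXn.
  have [lk|kl] := ltnP l k.+1.
    rewrite (bigD1 (Ordinal lk)) //= eqxx mulr1 big1 ?addr0 ?mulr_natl// => j.
    by rewrite -val_eqE /= eq_sym => /negbTE ->; rewrite mulr0 mul0rn.
  rewrite big1 ?bin_small ?mul0r// => j _.
  have /negbTE -> : l != j by rewrite gtn_eqF// (leq_trans _ kl).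
  by rewrite mulr0 mul0rn.
rewrite -coef_pow.
have -> : 1 + u *: 'X = u *: (1 + 1 *: 'X) + (1 - u)%:P :> {poly K}.
  by rewrite scale1r scalerDr alg_polyC polyCB addrAC addrCA subrr addr0.
rewrite exprDn coef_sum; apply: eq_bigr => i _.
rewrite coefMn exprZn -polyC_exp coefMC coefZ coef_pow expr1n.
by rewrite -mulr_natl; ring.
Qed.

Lemma sum_ffun_expr (K : comNzRingType) (r d : nat) (v : K) :
  \sum_(j : {ffun 'I_r -> 'I_d}) v ^+ (\sum_(l < r) j l)%N
  = (\sum_(k < d) v ^+ k) ^+ r.
Proof.
rewrite -[in RHS](card_ord r) -prodr_const bigA_distr_bigA /=.
by apply: eq_bigr => j _; rewrite prodrXr.
Qed.

(** Oddness of [d] is what makes [1 - (-v)^d] equal to [1 + v^d]. *)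
Lemma alternating_geometric_sum (K : fieldType) (r d : nat) (v : K) :
  odd d -> 1 + v != 0 ->
  \sum_(j : {ffun 'I_r -> 'I_d}) (- v) ^+ (\sum_(l < r) j l)%N
  = ((1 + v ^+ d) / (1 + v)) ^+ r.
Proof.
move=> od v1; rewrite sum_ffun_expr; congr (_ ^+ r).
apply: (mulIf v1); rewrite divfK//.
have := subrX1 (- v) d; rewrite exprNn -signr_odd od expr1 mulN1r => e.
apply: oppr_inj; transitivity ((- v - 1) * \sum_(k < d) (- v) ^+ k);
  [ring | rewrite -e; ring].
Qed.

(** One side of the symmetry in closed form: apart from [X], which will be
    [q^(abx)], the right-hand side is invariant under exchanging [a] and [b].
    [E] and [S] are kept abstract so that the computation takes place in an
    arbitrary field. *)
Lemma binomial_qEuler_sum (K : fieldType) (q X : K) (r n a b : nat)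
    (E : nat -> K) (S : nat -> K) :
  odd a -> q != 1 -> q ^+ a != 1 -> q ^+ b != 1 ->
  (forall l, 1 + q ^+ (b * l.+1) != 0) ->
  (forall k, E k = (1 + q ^+ a) ^+ r * (1 - q ^+ a) ^- k *
     \sum_(l < k.+1) 'C(k, l)%:R * (- X) ^+ l * (1 + q ^+ (a * l.+1)) ^- r) ->
  (forall i, S i = \sum_(j : {ffun 'I_r -> 'I_a})
    (-1) ^+ (\sum_(l < r) j l)%N
    * q ^+ (b * (n - i + 1) * \sum_(l < r) j l)%N
    * ((1 - q ^+ (b * \sum_(l < r) j l)%N) / (1 - q ^+ b)) ^+ i) ->
  (1 + q ^+ b) ^+ r *
    \sum_(0 <= i < n.+1)
       'C(n, i)%:R * ((1 - q ^+ a) / (1 - q)) ^+ (n - i)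
       * ((1 - q ^+ b) / (1 - q)) ^+ i * E (n - i)%N * S i
  = ((1 + q ^+ a) * (1 + q ^+ b)) ^+ r * (1 - q) ^- n *
    \sum_(l < n.+1) 'C(n, l)%:R * (- X) ^+ l *
      ((1 + q ^+ (a * b * l.+1))
       / ((1 + q ^+ (a * l.+1)) * (1 + q ^+ (b * l.+1)))) ^+ r.
Proof.
move=> oa q1 qa1 qb1 nz Ek Si; rewrite big_mkord.
pose w l := (1 + q ^+ (a * l.+1)) ^- r.
pose s (j : {ffun 'I_r -> 'I_a}) := (\sum_(l < r) j l)%N.
have term (i : 'I_n.+1) :
    'C(n, i)%:R * ((1 - q ^+ a) / (1 - q)) ^+ (n - i)
       * ((1 - q ^+ b) / (1 - q)) ^+ i * E (n - i)%N * S i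
    = (1 + q ^+ a) ^+ r * (1 - q) ^- n *
      \sum_(l < n.+1) \sum_(j : {ffun 'I_r -> 'I_a})
        (- X) ^+ l * w l * (- q ^+ b) ^+ (s j) *
        ('C(n, i)%:R * (q ^+ (b * s j)) ^+ (n - i)
          * (1 - q ^+ (b * s j)) ^+ i * 'C(n - i, l)%:R).
  rewrite Ek Si.
  have i_n : (i <= n)%N by rewrite -ltnS.
  have -> : \sum_(l < (n - i).+1)
         'C(n - i, l)%:R * (- X) ^+ l * (1 + q ^+ (a * l.+1)) ^- r
       = \sum_(l < n.+1) 'C(n - i, l)%:R * ((- X) ^+ l * w l).
    (* The binomial coefficients vanish beyond n - i, so l may run to n. *)
    rewrite (big_ord_widen n.+1
      (fun l => 'C(n - i, l)%:R * (- X) ^+ l * (1 + q ^+ (a * l.+1)) ^- r));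
      last by rewrite ltnS leq_subr.
    rewrite big_mkcond; apply: eq_bigr => l _; rewrite -mulrA.
    by case: ltnP => // /bin_small ->; rewrite mul0r.
  rewrite !expr_div_n.
  have e1 : (1 - q ^+ a) ^+ (n - i) != 0 by rewrite expf_neq0// subr_eq0 eq_sym.
  have e2 : (1 - q ^+ b) ^+ i != 0 by rewrite expf_neq0// subr_eq0 eq_sym.
  have e3 k : (1 - q) ^+ k != 0 by rewrite expf_neq0// subr_eq0 eq_sym.
  have -> : (1 - q) ^- n = (1 - q) ^- (n - i) * (1 - q) ^- i.
    by rewrite -invfM -exprD subnK.
  rewrite [X in _ * X = _](_ : _ = (1 - q ^+ b) ^- i *
    \sum_(j : {ffun 'I_r -> 'I_a}) (- q ^+ b) ^+ (s j) *
       (q ^+ (b * s j)) ^+ (n - i) * (1 - q ^+ (b * s j)) ^+ i); last first.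
    rewrite mulr_sumr; apply: eq_bigr => j _.
    rewrite -/(s j) expr_div_n mulnDr muln1 mulnDl exprD -!exprM.
    rewrite [in RHS]exprNn -exprM mulnAC.
    set A := (-1) ^+ _; set B := q ^+ _; set C := q ^+ _; set D := _ ^+ i.
    by ring.
  transitivity ((1 + q ^+ a) ^+ r * ((1 - q) ^- (n - i) * (1 - q) ^- i) *
    (\sum_(l < n.+1) 'C(n - i, l)%:R * ((- X) ^+ l * w l)) *
    ('C(n, i)%:R * \sum_(j : {ffun 'I_r -> 'I_a}) (- q ^+ b) ^+ (s j) *
       (q ^+ (b * s j)) ^+ (n - i) * (1 - q ^+ (b * s j)) ^+ i)).
    set s1 := \sum_(l < _) _; set s2 := \sum_(j : _) _.
    by field; rewrite !e3 e1 e2.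
  rewrite -mulrA; congr (_ * _); rewrite mulr_suml; apply: eq_bigr => l _.
  rewrite !mulr_sumr; apply: eq_bigr => j _.
  by ring.
under eq_bigr do rewrite term.
rewrite -mulr_sumr exchange_big /= exprMn !mulrA [(1 + q ^+ b) ^+ r * _]mulrC.
congr (_ * _); apply: eq_bigr => l _; rewrite exchange_big /=.
(* The sum over i is now the innermost one and collapses. *)
under eq_bigr do rewrite -mulr_sumr sum_bin_mul_bin.
rewrite [X in _ = _ * X](_ : _ = w l *
  \sum_(j : {ffun 'I_r -> 'I_a}) (- q ^+ (b * l.+1)) ^+ (s j)).
  rewrite !mulr_sumr; apply: eq_bigr => j _.
  rewrite (exprNn (q ^+ b)) (exprNn (q ^+ (b * l.+1))) -!exprM.
  have -> : (b * l.+1 * s j = b * s j + b * s j * l)%N.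
    by rewrite mulnAC mulnS.
  rewrite exprD; set A := (-1) ^+ _; set B := q ^+ _; set C := q ^+ _.
  by ring.
rewrite alternating_geometric_sum// -exprM /w -exprVn -exprMn.
have -> : (b * l.+1 * a = a * b * l.+1)%N by rewrite mulnC mulnA.
by rewrite invfM mulrCA.
Qed.

(** * Convergence of sequences and series *)

(** A counterpart of [series_cvg_to] for sequences: taking the topology from an
    explicit [numFieldType] lets it be used for sequences of complex numbers. *)
Definition seq_cvg_to (K : numFieldType) (u : nat -> K) (s : K) : Prop :=
  u @ \oo --> s.
Arguments seq_cvg_to {K}.

Lemma seq_cvg_toP (K : numFieldType) (u : nat -> K) (s : K) :
  seq_cvg_to u s <->
  forall e, 0 < e -> exists N, forall n, (N <= n)%N -> `|s - u n| < e.
Proof.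
split=> [/cvgrPdist_lt us e e0|us].
  by have [N _ uN] := us e e0; exists N => n /uN.
by apply/cvgrPdist_lt => e e0; have [N uN] := us e e0; exists N.
Qed.

Lemma seq_cvg_to_dominated (K : numFieldType) (u b : nat -> K) (s : K) :
  (forall n, `|s - u n| <= b n) -> seq_cvg_to b 0 -> seq_cvg_to u s.
Proof.
move=> ub /seq_cvg_toP b0; apply/seq_cvg_toP => e /b0[N bN]; exists N => n Nn.
rewrite (le_lt_trans (ub n))// (le_lt_trans _ (bN n Nn))// sub0r normrN.
by rewrite real_ler_norm// ger0_real// (le_trans _ (ub n)).
Qed.

Lemma seq_cvg_toD (K : numFieldType) (u v : nat -> K) (s t : K) :
  seq_cvg_to u s -> seq_cvg_to v t -> seq_cvg_to (fun n => u n + v n) (s + t).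
Proof. exact: cvgD. Qed.

Lemma seq_cvg_toM (K : numFieldType) (u v : nat -> K) (s t : K) :
  seq_cvg_to u s -> seq_cvg_to v t -> seq_cvg_to (fun n => u n * v n) (s * t).
Proof. exact: cvgM. Qed.

Lemma seq_cvg_to_cst (K : numFieldType) (s : K) : seq_cvg_to (fun=> s) s.
Proof. exact: cvg_cst. Qed.

Lemma series_cvg_to_sub (K : numFieldType) (u v : nat -> K) (w : nat -> K)
    (s : K) :
  series_cvg_to (fun n => u n * w n) s -> series_cvg_to (fun n => v n * w n) s ->
  series_cvg_to (fun n => (u n - v n) * w n) 0.
Proof.
move=> us vs; rewrite /series_cvg_to -(subrr s).
rewrite (_ : series _ = series (fun n => u n * w n) \- series (fun n => v n * w n)).
  exact: cvgB.
by apply/funext => N; rewrite /series /= -sumrB; apply: eq_bigr => n _; rewrite mulrBl.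
Qed.

Lemma series_cvg_toZ (K : numFieldType) (a : K) (u v : nat -> K) (s : K) :
  series_cvg_to (fun n => u n * v n) s ->
  series_cvg_to (fun n => a * u n * v n) (a * s).
Proof.
move=> us; rewrite /series_cvg_to.
rewrite (_ : series _ = fun N => a * series (fun n => u n * v n) N).
  exact: cvgMr.
by apply/funext => N; rewrite /series /= mulr_sumr; apply: eq_bigr => n _; rewrite mulrA.
Qed.

Lemma seq_cvg_to_real (R : realType) (x : nat -> R) (a : R) :
  x @ \oo --> a -> seq_cvg_to (fun n => (x n)%:C) a%:C.
Proof.
move=> /seq_cvg_toP xa; apply/seq_cvg_toP => e e0.
have er : e = (complex.Re e)%:C by rewrite RRe_real// gtr0_real.
have e0' : 0 < complex.Re e by rewrite -ltcR -er.
have [N xN] := xa _ e0'; exists N => n /xN; rewrite -rmorphB er /=.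
by rewrite -ltcR normc_def /= expr0n addr0 sqrtr_sqr.
Qed.

Lemma seq_cvg_to_complex (R : realType) (x y : nat -> R) (a b : R) :
  x @ \oo --> a -> y @ \oo --> b ->
  seq_cvg_to (fun n => x n +i* y n) (a +i* b).
Proof.
move=> xa yb.
have -> : (fun n => x n +i* y n) = (fun n => (x n)%:C + 'i%C * (y n)%:C).
  by apply/funext => n; rewrite [LHS]complexE.
rewrite (complexE (a +i* b)) /=; apply: seq_cvg_toD; first exact: seq_cvg_to_real.
by apply: seq_cvg_toM; [exact: seq_cvg_to_cst|exact: seq_cvg_to_real].
Qed.

(** Absolute convergence of complex series, reduced to the completeness of the
    reals through real and imaginary parts. *)
Lemma series_cvg_to_dominated (R : realType) (c : nat -> R[i]) (b : nat -> R) :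
  (forall n, `|c n| <= (b n)%:C) -> cvg (series b @ \oo) ->
  exists s, series_cvg_to c s.
Proof.
move=> cb cvb.
have part (p : R[i] -> R) : (forall z, (`|p z|)%:C <= `|z|) ->
    exists a : R, series (fun n => p (c n)) @ \oo --> a.
  move=> pn; apply/cvg_ex; apply: normed_cvg.
  have pb n : `|p (c n)| <= b n by rewrite -lecR (le_trans (pn _)).
  apply: (@series_le_cvg _ _ b _ _ pb cvb) => n; first exact: normr_ge0.
  exact: le_trans (pb n).
have [a ca] := part (@complex.Re R) (fun z => normc_ge_Re z).
have norm_ge_Im (z : R[i]) : (`|complex.Im z|)%:C <= `|z|.
  have := normc_ge_Re (z * 'i%C); rewrite ReiNIm normrN normrM (normc_def 'i%C).
  by rewrite /= expr0n add0r expr1n sqrtr1 mulr1.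
have [a' ca'] := part (@complex.Im R) norm_ge_Im.
exists (a +i* a'); have := seq_cvg_to_complex _ _ _ _ _ ca ca'.
rewrite (_ : (fun n => _ +i* _) = series c)//.
apply/funext => n; rewrite /series /=.
by elim/big_rec3 : _ => //= k x y z _ <-; case: (c k).
Qed.

(** * Unordered sums *)

#[local] Existing Instance totally_filter.

(** Unordered summation is convergence along the filter of finite subsets, so
    the general theory of limits applies to it. *)
Lemma has_sum_cvg (K : numFieldType) (I : choiceType) (f : I -> K) (s : K) :
  has_sum f s <-> (fun A : {fset I} => \sum_(k <- A) f k) @ totally --> s.
Proof.
split=> [fs|/cvgrPdist_lt fs e e0].
  by apply/cvgrPdist_lt => e e0; have [A sA] := fs e e0; exists A.
by have [A _ sA] := fs e e0; exists A.
Qed.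

Lemma has_sum_unique (K : numFieldType) (I : choiceType) (f : I -> K) (s t : K) :
  has_sum f s -> has_sum f t -> s = t.
Proof.
by move=> /has_sum_cvg fs /has_sum_cvg ft; exact: (cvg_unique _ fs ft).
Qed.

Lemma has_sum_lincomb (K : numFieldType) (I : choiceType) (n : nat)
    (c : nat -> K) (f : nat -> I -> K) (s : nat -> K) :
  (forall l, (l < n)%N -> has_sum (f l) (s l)) ->
  has_sum (fun i => \sum_(l < n) c l * f l i) (\sum_(l < n) c l * s l).
Proof.
move=> fs; apply/has_sum_cvg.
under eq_fun do rewrite exchange_big /=.
apply: cvg_big => // [x y|l _]; first exact: add_continuous.
under eq_fun do rewrite -mulr_sumr.
by apply: cvgMr; apply/has_sum_cvg; exact: fs.
Qed.

Lemma has_sum_norm_le (K : numFieldType) (I : choiceType) (f : I -> K)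
    (s H : K) :
  has_sum f s -> (forall A : {fset I}, \sum_(k <- A) `|f k| <= H) -> `|s| <= H.
Proof.
move=> fs fH; apply/ler_addgt0Pl => e e0; have [A sA] := fs e e0.
rewrite -(subrK (\sum_(k <- A) f k) s) (le_trans (ler_normD _ _))//.
by rewrite lerD ?(ltW (sA A _))// (le_trans (ler_norm_sum _ _ _)).
Qed.

(** Exchange of a limit with an unordered sum. The error committed on the term
    [i] is at most [d N * h i]; since the finite sums of [h] are bounded, the
    error on every finite sum tends to 0 uniformly. *)
Lemma has_sum_uniform_limit (K : numFieldType) (I : choiceType) (f : I -> K)
    (g : nat -> I -> K) (h : I -> K) (s d : nat -> K) (S H : K) :
  (forall N, 0 <= d N) -> (forall N i, `|f i - g N i| <= d N * h i) ->
  (forall A : {fset I}, \sum_(i <- A) h i <= H) ->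
  seq_cvg_to d 0 -> (forall N, has_sum (g N) (s N)) -> seq_cvg_to s S ->
  has_sum f S.
Proof.
move=> d0 fg hH dlim gs slim e e0.
have e4 : 0 < e / 3%:R by rewrite divr_gt0.
have dH : (fun N => d N * H) @ \oo --> 0 by rewrite -(mul0r H); exact: cvgMl.
have [N1 _ slimN] := (cvgrPdist_lt _ _).1 slim _ e4.
have [N2 _ dlimN] := (cvgrPdist_lt _ _).1 dH _ e4.
pose N := maxn N1 N2.
have [A sA] := gs N _ e4; exists A => B AB.
have -> : S - \sum_(k <- B) f k = (S - s N) + (s N - \sum_(k <- B) g N k)
   - (\sum_(k <- B) f k - \sum_(k <- B) g N k) by ring.
have -> : e = e / 3%:R + e / 3%:R + e / 3%:R.
  by field.
rewrite (le_lt_trans (ler_normB _ _))// ltrD//.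
  by rewrite (le_lt_trans (ler_normD _ _))// ltrD ?sA// slimN//= leq_maxl.
rewrite -sumrB (le_lt_trans (ler_norm_sum _ _ _))//.
apply: (@le_lt_trans _ _ (d N * H)).
  apply: (@le_trans _ _ (\sum_(k <- B) d N * h k)); first exact: ler_sum.
  by rewrite -mulr_sumr ler_wpM2l.
have := dlimN N (leq_maxr _ _); rewrite sub0r normrN.
by apply: le_lt_trans; rewrite real_ler_norm// realM ?ger0_real// -(big_seq_fset0 +%R h).
Qed.

Lemma sum_fsetD (V : zmodType) (I : choiceType) (f : I -> V)
    (A B : {fset I}) : (A `<=` B)%fset ->
  \sum_(k <- B) f k - \sum_(k <- A) f k = \sum_(k <- (B `\` A)%fset) f k.
Proof.
move=> AB; rewrite (big_fsetID _ (mem A) B) /=.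
have -> : [fset x in B | x \in A]%fset = A.
  by apply/fsetP => x; rewrite !inE andbC andb_idr//; exact: (fsubsetP AB).
rewrite addrAC subrr add0r; apply: eq_fbigl => x.
by rewrite !inE andbC.
Qed.

(** For a dominated family it suffices to sum along one exhausting sequence of
    finite sets: what a larger finite set adds is bounded by what it adds to the
    convergent sums of the dominating family. *)
Lemma has_sum_exhaust (K : numFieldType) (I : choiceType) (f h : I -> K)
    (A : nat -> {fset I}) (s H : K) :
  (forall B : {fset I}, exists M, forall N, (M <= N)%N -> (B `<=` A N)%fset) ->
  (forall i, `|f i| <= h i) ->
  seq_cvg_to (fun N => \sum_(i <- A N) f i) s ->
  seq_cvg_to (fun N => \sum_(i <- A N) h i) H ->
  has_sum f s.
Proof.
move=> exh fh fs hH e e0.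
have e3 : 0 < e / 3%:R by rewrite divr_gt0.
have [N1 _ fsN] := (cvgrPdist_lt _ _).1 fs _ e3.
have [N2 _ hHN] := (cvgrPdist_lt _ _).1 hH _ e3.
pose N := maxn N1 N2; exists (A N) => B AB.
have [M MN] := exh B; pose P := maxn M N.
have BP : (B `<=` A P)%fset by rewrite MN// leq_maxl.
have -> : s - \sum_(k <- B) f k = (s - \sum_(k <- A N) f k)
   - (\sum_(k <- B) f k - \sum_(k <- A N) f k) by ring.
have -> : e = e / 3%:R + (e / 3%:R + e / 3%:R) by field.
rewrite (le_lt_trans (ler_normB _ _))// ltrD//; first by rewrite fsN//= leq_maxl.
have h0 i : 0 <= h i by rewrite (le_trans _ (fh i)).
rewrite sum_fsetD// (le_lt_trans (ler_norm_sum _ _ _))//.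
apply: (@le_lt_trans _ _ (\sum_(k <- A P) h k - \sum_(k <- A N) h k)).
  apply: (@le_trans _ _ (\sum_(k <- (B `\` A N)%fset) h k)); first exact: ler_sum.
  rewrite sum_fsetD ?(fsubset_trans AB)// -subr_ge0.
  by rewrite sum_fsetD ?fsetSD// sumr_ge0.
rewrite (le_lt_trans (real_ler_norm _))//.
  by rewrite realB// ger0_real// sumr_ge0.
have -> : \sum_(k <- A P) h k - \sum_(k <- A N) h k
  = (H - \sum_(k <- A N) h k) - (H - \sum_(k <- A P) h k) by ring.
rewrite (le_lt_trans (ler_normB _ _))// ltrD// hHN//=.
  by rewrite leq_maxr.
by rewrite (leq_trans (leq_maxr N1 N2))// leq_maxr.
Qed.

(** The cube {0..N-1}^r inside N^r. *)
Definition box (r N : nat) : {fset {ffun 'I_r -> nat}} :=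
  [fset ([ffun l => nat_of_ord ((j : {ffun 'I_r -> 'I_N}) l)]
           : {ffun 'I_r -> nat})
    | j in {: {ffun 'I_r -> 'I_N}}]%fset.

Lemma box_exhaust (r : nat) (B : {fset {ffun 'I_r -> nat}}) :
  exists M, forall N, (M <= N)%N -> (B `<=` box r N)%fset.
Proof.
exists (\max_(m <- B) \max_(l < r) m l)%N.+1 => N MN.
apply/fsubsetP => m mB; apply/imfsetP => /=.
have mN l : (m l < N)%N.
  apply: leq_trans MN; rewrite ltnS.
  apply: leq_trans
    (@leq_bigmax_seq _ (enum_fset B) xpredT
       (fun m : {ffun 'I_r -> nat} => \max_(l < r) m l)%N m mB isT).
  exact: (leq_bigmax (F := fun l => m l)).
exists [ffun l => Ordinal (mN l)] => //.
by apply/ffunP => l; rewrite !ffunE.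
Qed.

(** Over a cube the sum factors into [r] one-dimensional geometric sums. *)
Lemma sum_box_expr (K : comNzRingType) (r N : nat) (z : K) :
  \sum_(m <- box r N) z ^+ (\sum_(l < r) m l)%N = (\sum_(k < N) z ^+ k) ^+ r.
Proof.
rewrite big_imfset /=; last first.
  move=> i j _ _ /ffunP eij; apply/ffunP => l; apply: val_inj.
  by have := eij l; rewrite !ffunE.
rewrite big_enum /= -sum_ffun_expr; apply: eq_bigr => j _.
by congr (_ ^+ _); apply: eq_bigr => l _; rewrite ffunE.
Qed.

Lemma seq_cvg_toX (K : numFieldType) (u : nat -> K) (s : K) (r : nat) :
  seq_cvg_to u s -> seq_cvg_to (fun n => u n ^+ r) (s ^+ r).
Proof.
move=> us; elim: r => [|r IH]; first by rewrite expr0; exact: cvg_cst.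
rewrite exprS; under eq_fun do rewrite exprS; exact: cvgM.
Qed.

Lemma cvg_geometric_sum (K : numFieldType) (z : K) :
  `|z| < 1 -> seq_cvg_to (fun n => `|z| ^+ n) 0 ->
  seq_cvg_to (fun n => \sum_(k < n) z ^+ k) (1 - z)^-1.
Proof.
move=> z1 zn; have z1' : 1 - z != 0.
  by rewrite subr_eq0; apply: contraTneq z1 => <-; rewrite normr1 ltxx.
have -> : (fun n => \sum_(k < n) z ^+ k) = (fun n => (1 - z ^+ n) * (1 - z)^-1).
  apply/funext => n; apply: (mulfI z1'); rewrite [RHS]mulrC divfK//.
  by rewrite -(opprB z) mulNr -subrX1 opprB.
rewrite -[X in seq_cvg_to _ X]mul1r; apply: cvgMl; rewrite -[X in _ --> X]subr0.
apply: cvgB; first exact: cvg_cst.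
by apply/norm_cvg0P; under eq_fun do rewrite normrX.
Qed.

Lemma has_sum_geometric (K : numFieldType) (r : nat) (z : K) :
  `|z| < 1 -> seq_cvg_to (fun n => `|z| ^+ n) 0 ->
  has_sum (fun m : {ffun 'I_r -> nat} => z ^+ (\sum_(l < r) m l)%N)
    ((1 - z) ^- r).
Proof.
move=> z1 zn.
apply: (@has_sum_exhaust _ _ _
   (fun m : {ffun 'I_r -> nat} => `|z| ^+ (\sum_(l < r) m l)%N)
   (box r) _ ((1 - `|z|) ^- r)).
- exact: box_exhaust.
- by move=> m; rewrite normrX.
- under eq_fun do rewrite sum_box_expr.
  by rewrite -exprVn; apply: seq_cvg_toX; apply: cvg_geometric_sum.
- under eq_fun do rewrite sum_box_expr.
  by rewrite -exprVn; apply: seq_cvg_toX; apply: cvg_geometric_sum; rewrite normr_id.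
Qed.

Lemma sum_geometric_le (K : numFieldType) (r : nat) (z : K)
    (A : {fset {ffun 'I_r -> nat}}) :
  0 <= z -> z < 1 ->
  \sum_(m <- A) z ^+ (\sum_(l < r) m l)%N <= (1 - z) ^- r.
Proof.
move=> z0 z1; have [M /(_ M (leqnn M)) AM] := box_exhaust r A.
apply: (@le_trans _ _ (\sum_(m <- box r M) z ^+ (\sum_(l < r) m l)%N)).
  by rewrite -subr_ge0 sum_fsetD// sumr_ge0// => m _; rewrite exprn_ge0.
rewrite sum_box_expr -exprVn lerXn2r// ?nnegrE ?sumr_ge0//.
- by move=> k _; rewrite exprn_ge0.
- by rewrite invr_ge0 subr_ge0 ltW.
rewrite -[leRHS]mul1r ler_pdivlMr ?subr_gt0//.
by rewrite mulrC -(opprB z) mulNr -subrX1 opprB gerBl exprn_ge0.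
Qed.

(** * The complex exponential series *)

Definition exp_term (K : numFieldType) (z : K) (n : nat) : K := z ^+ n / n`!%:R.
Arguments exp_term {K}.

(** A named constant over [numFieldType], rather than [series] itself, so that
    the real and the complex partial sums are seen in the same structure. *)
Definition exp_psum (K : numFieldType) (z : K) (N : nat) : K :=
  series (exp_term z) N.
Arguments exp_psum {K}.

Lemma dist_exp_psum_le (K : numFieldType) (z w : K) (M N : nat) :
  `|z| <= w -> (N <= M)%N ->
  `|exp_psum z M - exp_psum z N|
     <= exp_psum w M - exp_psum w N.
Proof.
move=> zw NM; have es (x : K) : exp_psum x M - exp_psum x N
    = \sum_(N <= k < M) exp_term x k by rewrite -sub_series_geq.
rewrite !es (le_trans (ler_norm_sum _ _ _))//.
apply: ler_sum => n _; rewrite /exp_term normrM normfV normrX normr_nat.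
by rewrite ler_wpM2r ?invr_ge0// lerXn2r// nnegrE (le_trans _ zw).
Qed.

(** The product of two partial sums contains, besides the terms of the partial
    sum at [z + w], exactly the pairs of total degree at least [N]. *)
Lemma exp_psumM_sub (K : numFieldType) (z w : K) (N : nat) :
  exp_psum z N * exp_psum w N - exp_psum (z + w) N
  = \sum_(0 <= i < N) \sum_(N - i <= k < N) exp_term z k * exp_term w i.
Proof.
have termD n : exp_term (z + w) n
    = \sum_(0 <= i < n.+1) exp_term z (n - i) * exp_term w i.
  rewrite /exp_term exprDn mulr_suml big_mkord; apply: eq_bigr => i _.
  have i_n : (i <= n)%N by rewrite -ltnS.
  have fact0 k : (k`!%:R : K) != 0 by rewrite pnatr_eq0 -lt0n fact_gt0.
  rewrite -mulr_natr -(bin_fact i_n) !natrM.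
  have bin0 : ('C(n, i)%:R : K) != 0 by rewrite pnatr_eq0 -lt0n bin_gt0.
  by field; rewrite !fact0 bin0.
have -> : exp_psum (z + w) N
    = \sum_(0 <= i < N) \sum_(0 <= k < N - i) exp_term z k * exp_term w i.
  rewrite /exp_psum /series /=; under eq_bigr do rewrite termD.
  transitivity (\sum_(0 <= n < N) \sum_(0 <= i < N | (i < n.+1)%N)
     exp_term z (n - i) * exp_term w i).
    by apply: eq_big_nat => n /andP[_ nN]; rewrite [LHS](big_nat_widen _ _ N).
  rewrite (exchange_big_dep_nat xpredT)//=; apply: eq_bigr => i _.
  under eq_bigl do rewrite ltnS.
  rewrite -(big_nat_widenl i 0 N xpredT
    (fun n => exp_term z (n - i) * exp_term w i))//.
  rewrite -[X in \sum_(X <= _ < _) _]add0n big_addn.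
  by apply: eq_bigr => k _; rewrite addnK.
rewrite /exp_psum /series /= mulr_sumr -sumrB; apply: eq_bigr => i _.
rewrite mulr_suml (big_cat_nat (leq0n (N - i)) (leq_subr i N))/=.
by rewrite addrAC subrr add0r.
Qed.

(** The defect of multiplicativity is dominated by the same defect at the
    absolute values, which tends to 0 by the real functional equation. *)
Lemma dist_exp_psumM_le (K : numFieldType) (z w : K) (N : nat) :
  `|exp_psum z N * exp_psum w N - exp_psum (z + w) N|
  <= exp_psum `|z| N * exp_psum `|w| N
     - exp_psum (`|z| + `|w|) N.
Proof.
rewrite !exp_psumM_sub (le_trans (ler_norm_sum _ _ _))// ler_sum// => i _.
rewrite (le_trans (ler_norm_sum _ _ _))// ler_sum// => k _.
by rewrite /exp_term !normrM !normfV !normrX !normr_nat.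
Qed.

Lemma exp_psum_real (R : realType) (x : R) (N : nat) :
  exp_psum x%:C N = (exp_psum x N)%:C.
Proof.
rewrite /exp_psum /series /= rmorph_sum; apply: eq_bigr => i _.
by rewrite /exp_term rmorphM rmorphXn /= fmorphV rmorph_nat.
Qed.

Lemma exp_psum_cvg (R : realType) (x : R) :
  exp_psum x @ \oo --> expR x.
Proof. exact: is_cvg_series_exp_coeff. Qed.

(** The powers of the imaginary unit alternate between the real and imaginary
    axes, which splits the series term by term into those of cosine and sine. *)
Lemma exp_psum_imaginary (R : realType) (y : R) (N : nat) :
  exp_psum (0 +i* y) N
  = series (cos_coeff y) N +i* series (sin_coeff y) N.
Proof.
have mulCE (a b c d : R) : (a +i* b) * (c +i* d)
  = (a * c - b * d) +i* (a * d + b * c) by [].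
have i_pow n : (0 +i* y) ^+ n = ((~~ odd n)%:R * (-1) ^+ n./2 * y ^+ n)
    +i* ((odd n)%:R * (-1) ^+ n.-1./2 * y ^+ n) :> R[i].
  elim: n => [|n IH].
    by rewrite !expr0 /= !mulr1.
  rewrite exprS IH mulCE !mul0r !add0r; congr (_ +i* _).
    case: n {IH} => [|n]; first by rewrite /= !mul0r mulr0 oppr0.
    by rewrite /= negbK !exprS; case: (odd n) => /=; ring.
  by rewrite /= exprS mulrCA.
rewrite /exp_psum /series /=; elim/big_rec3 : _ => //= n a b c _ ->.
rewrite /exp_term i_pow -(rmorph_nat (real_complex R)) -fmorphV /=.
by rewrite mulCE !mulr0 subr0 add0r.
Qed.

(** [expC] is defined through [expR], [cos] and [sin]; the series at [u + iv] is
    compared with the product of the series at [u] and at [iv]. *)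
Lemma series_exp_term_expC (R : realType) (z : R[i]) :
  series_cvg_to (exp_term z) (expC z).
Proof.
case: z => u v /=; set w := 0 +i* v.
have -> : u +i* v = u%:C + w by rewrite /w; congr (_ +i* _); rewrite ?addr0 ?add0r.
have prod_cvg : seq_cvg_to
    (fun N => exp_psum u%:C N * exp_psum w N)
    ((expR u)%:C * (cos v +i* sin v)).
  apply: seq_cvg_toM.
    rewrite (funext (exp_psum_real R u)).
    by apply: seq_cvg_to_real; exact: exp_psum_cvg.
  rewrite (funext (exp_psum_imaginary R v)).
  apply: seq_cvg_to_complex.
    by rewrite unlock; exact: is_cvg_series_cos_coeff.
  by rewrite unlock; exact: is_cvg_series_sin_coeff.
have nu : `|u%:C| = `|u|%:C by rewrite normc_def /= expr0n addr0 sqrtr_sqr.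
have nv : `|w| = `|v|%:C by rewrite normc_def /= expr0n add0r sqrtr_sqr.
pose b N := exp_psum `|u| N * exp_psum `|v| N
   - exp_psum (`|u| + `|v|) N.
have b0 : seq_cvg_to (fun N => (b N)%:C) 0.
  apply: seq_cvg_to_real; rewrite -(subrr (expR `|u| * expR `|v|)) -{2}expRD.
  by apply: cvgB; [apply: cvgM|]; exact: exp_psum_cvg.
have diff_cvg : seq_cvg_to (fun N => exp_psum (u%:C + w) N
    - exp_psum u%:C N * exp_psum w N) 0.
  apply: (seq_cvg_to_dominated _ _ _ _ _ b0) => N.
  rewrite sub0r opprB (le_trans (dist_exp_psumM_le _ _ _ _))// nu nv -rmorphD /=.
  rewrite (exp_psum_real _ `|u|).
  rewrite (exp_psum_real _ `|v|).
  rewrite (exp_psum_real _ (`|u| + `|v|)).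
  rewrite /b.
  by rewrite (rmorphB (real_complex R)) (rmorphM (real_complex R)).
have := seq_cvg_toD _ _ _ _ _ diff_cvg prod_cvg; rewrite add0r.
by under eq_fun do rewrite subrK.
Qed.

(** The bound depends on [z] only through a bound on its modulus, which is the
    uniformity needed to sum over infinitely many arguments. *)
Lemma expC_tail_le (R : realType) (z : R[i]) (w : R) (N : nat) :
  `|z| <= w%:C ->
  `|expC z - exp_psum z N| <= (expR w - exp_psum w N)%:C.
Proof.
move=> zw; apply/ler_addgt0Pl => e e0.
(* Compare with a partial sum of order P >= N that is e-close to the limit. *)
have [M MM] := (seq_cvg_toP _ _ _).1 (series_exp_term_expC R z) e e0.
pose P := maxn M N.
rewrite -(subrK (exp_psum z P) (expC z)) -addrA.
rewrite (le_trans (ler_normD _ _))// lerD//; first by rewrite ltW// MM// leq_maxl.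
rewrite (le_trans (dist_exp_psum_le _ _ _ _ _ zw (leq_maxr _ _)))//.
rewrite 2!exp_psum_real -rmorphB lecR lerB//.
have w0 : 0 <= w by rewrite -ler0c (le_trans _ zw).
have nd : nondecreasing_seq (exp_psum w).
  apply: (nondecreasing_series (P := xpredT)) => n _ _.
  by rewrite divr_ge0// exprn_ge0.
have cv := exp_psum_cvg R w.
rewrite -(cvg_lim _ cv)//; apply: nondecreasing_cvgn_le => //.
Qed.

Lemma expCD (R : realType) (z w : R[i]) : expC (z + w) = expC z * expC w.
Proof.
case: z w => [x1 y1] [x2 y2] /=.
rewrite expRD cosD sinD rmorphM mulrACA; congr (_ * _).
by congr (_ +i* _); ring.
Qed.

Lemma expC_natM (R : realType) (n : nat) (z : R[i]) :
  expC (n%:R * z) = expC z ^+ n.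
Proof.
elim: n => [|n IH].
  by rewrite mul0r expr0 /= expR0 cos0 sin0 mul1r.
by rewrite -natr1 mulrDl mul1r expCD IH exprSr.
Qed.

(** * Exponential generating functions *)

(** If [c k] is the first nonzero coefficient, then for small [t > 0] the term
    [c k * t^k] outweighs the rest of the series, whose coefficients are bounded
    because the series converges at [t = 1]. *)
Lemma power_series_eq0 (K : numFieldType) (c : nat -> K) :
  (forall t, series_cvg_to (fun n => c n * t ^+ n) 0) -> forall k, c k = 0.
Proof.
move=> c0.
have [B B0 cB] : exists2 B, 0 < B & forall n, `|c n| <= B.
  have : c @ \oo --> (0 : K).
    have := c0 1; rewrite /series_cvg_to.
    under eq_fun do rewrite expr1n mulr1.
    by move=> /cvgP/cvg_series_cvg_0.
  by move=> /cvgP/cvg_seq_bounded/pinfty_ex_gt0[B B0 cB]; exists B => // n; exact: cB.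
elim/ltn_ind => k IH; apply/eqP; apply: contraT => ck0.
(* With this t the tail, at most 2 B t^(k+1), is half of |c k| t^k. *)
pose t := `|c k| / (4%:R * B).
have nck : 0 < `|c k| by rewrite normr_gt0.
have t0 : 0 < t by rewrite divr_gt0// mulr_gt0.
have t_le : t <= 2^-1.
  rewrite ler_pdivrMr ?mulr_gt0// (le_trans (cB k))//.
  have -> : 2^-1 * (4%:R * B) = B + B by field.
  by rewrite lerDl ltW.
have geo n : \sum_(0 <= j < n) t ^+ j <= 2%:R.
  have S0 : 0 <= \sum_(0 <= j < n) t ^+ j.
    by rewrite sumr_ge0// => j _; rewrite exprn_ge0// ltW.
  rewrite -(ler_pM2r (_ : 0 < 2^-1)) ?invr_gt0// divff//.
  apply: (@le_trans _ _ ((\sum_(0 <= j < n) t ^+ j) * (1 - t))).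
    have half : 2^-1 = 1 - 2^-1 :> K by field.
    by rewrite ler_wpM2l// [leLHS]half lerB.
  by rewrite mulrC -(opprB t) mulNr big_mkord -subrX1 opprB gerBl exprn_ge0// ltW.
have [N sN] := (seq_cvg_toP _ _ _).1 (c0 t) (t ^+ k * `|c k| / 2%:R)
   (divr_gt0 (mulr_gt0 (exprn_gt0 _ t0) nck) (ltr0n _ 2)).
have := sN (maxn N k.+1) (leq_maxl _ _); set M := maxn _ _.
have kM : (k < M)%N by rewrite leq_maxr.
rewrite sub0r normrN /series /= (big_cat_nat (leq0n k) (ltnW kM))/=.
rewrite [X in `|X + _|]big_nat_cond big1 ?add0r; last first.
  by move=> i /andP[/andP[_ ik] _]; rewrite IH// mul0r.
rewrite big_ltn// => /(le_lt_trans (lerB_normD _ _)).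
suff tail : `|\sum_(k.+1 <= i < M) c i * t ^+ i| <= t ^+ k * `|c k| / 2%:R.
  rewrite ltrBlDr normrM [ `|t ^+ k|]ger0_norm ?exprn_ge0 ?(ltW t0)//.
  rewrite mulrC => /lt_le_trans/(_ (lerD (lexx _) tail)).
  by rewrite -splitr ltxx.
rewrite (le_trans (ler_norm_sum _ _ _))//.
apply: (@le_trans _ _ (\sum_(k.+1 <= i < M) B * t ^+ i)).
  apply: ler_sum => i _; rewrite normrM [ `|t ^+ i|]ger0_norm ?exprn_ge0 ?(ltW t0)//.
  by rewrite ler_wpM2r// exprn_ge0// ltW.
rewrite -mulr_sumr -[X in \sum_(X <= _ < _) _]add0n big_addn.
under eq_bigr do rewrite exprD.
rewrite -mulr_suml exprS.
have -> : t ^+ k * `|c k| / 2%:R = B * (2%:R * (t * t ^+ k)).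
  by rewrite /t; field; rewrite gt_eqF.
by rewrite ler_wpM2l ?(ltW B0)// ler_wpM2r// mulr_ge0 ?exprn_ge0 ?(ltW t0).
Qed.

(** If [e k] are the moments of a summable family of masses [a i] placed at
    bounded points [w i], then the exponential generating function of [e] is
    the sum of the exponentials. *)
Lemma has_sum_expC (R : realType) (I : choiceType) (a w : I -> R[i])
    (e : nat -> R[i]) (H W : R) (t : R[i]) :
  (forall A : {fset I}, \sum_(i <- A) `|a i| <= H%:C) ->
  0 <= W -> (forall i, `|w i| <= W%:C) ->
  (forall k, has_sum (fun i => a i * w i ^+ k) (e k)) ->
  exists2 G, has_sum (fun i => a i * expC (w i * t)) G
    & series_cvg_to (fun n => e n * (t ^+ n / n`!%:R)) G.
Proof.
move=> aH W0 wW mom.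
pose T := complex.Re `|t|; have tT : `|t| = T%:C by rewrite RRe_real// normr_real.
have e_le n : `|e n| <= (H * W ^+ n)%:C.
  apply: (has_sum_norm_le _ _ _ _ _ (mom n)) => A.
  apply: (@le_trans _ _ (\sum_(i <- A) `|a i| * (W ^+ n)%:C)).
    apply: ler_sum => i _; rewrite normrM ler_wpM2l// normrX rmorphXn.
    by rewrite lerXn2r// nnegrE (le_trans _ (wW i)).
  by rewrite -mulr_suml rmorphM ler_wpM2r// ler0c exprn_ge0.
have [G Gcvg] : exists G, series_cvg_to (fun n => e n * (t ^+ n / n`!%:R)) G.
  apply: (series_cvg_to_dominated _ _ (fun n => H * exp_term (W * T) n)).
    move=> n; rewrite 2!normrM normfV normrX normr_nat tT.
    have -> : (H * exp_term (W * T) n)%:C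
        = (H * W ^+ n)%:C * (T%:C ^+ n / n`!%:R).
      rewrite /exp_term exprMn.
      have -> : H * (W ^+ n * T ^+ n / n`!%:R) = H * W ^+ n * (T ^+ n / n`!%:R).
        by ring.
      rewrite (rmorphM (real_complex R)) /=; congr (_ * _).
      by rewrite (rmorphM (real_complex R)) /= rmorphXn fmorphV rmorph_nat.
    by rewrite ler_wpM2r// divr_ge0// exprn_ge0// -tT.
  have -> : series (fun n => H * exp_term (W * T) n)
      = fun N => H * exp_psum (W * T) N.
    by apply/funext => N; rewrite /exp_psum /series /= mulr_sumr.
  apply/cvg_ex; exists (H * expR (W * T)); apply: cvgMr.
  exact: exp_psum_cvg.
exists G => //.
apply: (has_sum_uniform_limit _ _ _ (fun N i => a i * exp_psum (w i * t) N)
  _ _ (fun N => (expR (W * T) - exp_psum (W * T) N)%:C) G _ _ _ aH _ _ Gcvg).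
- move=> N; rewrite (le_trans _ (expC_tail_le R 0 (W * T) N _))//.
  by rewrite normr0 ler0c mulr_ge0// -ler0c -tT.
- move=> N i; rewrite -mulrBr normrM mulrC ler_wpM2r//.
  apply: expC_tail_le; rewrite normrM tT rmorphM ler_wpM2r//.
  by rewrite -tT.
- rewrite -[X in seq_cvg_to _ X]/(0%:C) -(subrr (expR (W * T))).
  apply: (seq_cvg_to_real R (fun N => expR (W * T) - exp_psum (W * T) N)).
  by apply: cvgB; [exact: cvg_cst|exact: exp_psum_cvg].
- move=> N; rewrite /series /= big_mkord.
  have := @has_sum_lincomb _ _ N (fun n => t ^+ n / n`!%:R) _ _ (fun l _ => mom l).
  congr has_sum; last by apply: eq_bigr => n _; rewrite mulrC.
  apply/funext => i; rewrite /exp_psum /series /= big_mkord mulr_sumr.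
  by apply: eq_bigr => n _; rewrite /exp_term exprMn; ring.
Qed.

(** * The q-Euler polynomials *)

Lemma qpow_nat (R : realType) (q lq : R[i]) (n : nat) :
  expC lq = q -> qpow lq n%:R = q ^+ n.
Proof. by move=> <-; rewrite /qpow rmorph_nat expC_natM. Qed.

Lemma qpowD (R : realType) (lq : R[i]) (x y : R) :
  qpow lq (x + y) = qpow lq x * qpow lq y.
Proof. by rewrite /qpow rmorphD mulrDl expCD. Qed.

Lemma qnum_nat (R : realType) (q lq : R[i]) (c n : nat) :
  expC lq = q -> qnum q lq c n%:R = (1 - q ^+ (c * n)) / (1 - q ^+ c).
Proof. by move=> hq; rewrite /qnum -natrM (qpow_nat _ q). Qed.

Lemma qnum_two (R : realType) (q lq : R[i]) (c : nat) :
  expC lq = q -> q ^+ c != 1 -> qnum q lq c 2 = 1 + q ^+ c.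
Proof.
move=> hq qc; rewrite qnum_nat// exprM; field.
by rewrite subr_eq0 eq_sym.
Qed.

Lemma qnum_natD (R : realType) (q lq : R[i]) (c n : nat) (y : R) :
  expC lq = q -> qnum q lq c (n%:R + y)
  = (1 - (q ^+ c) ^+ n * qpow lq (c%:R * y)) / (1 - q ^+ c).
Proof. by move=> hq; rewrite /qnum mulrDr qpowD -natrM (qpow_nat _ q)// exprM. Qed.

Lemma seq_cvg_to_norm_expr0 (R : realType) (z : R[i]) :
  `|z| < 1 -> seq_cvg_to (fun n => `|z| ^+ n) 0.
Proof.
have zr : `|z| = (complex.Re `|z|)%:C by rewrite RRe_real// normr_real.
rewrite zr => z1.
rewrite (_ : (fun _ => _) = fun n => ((complex.Re `|z|) ^+ n)%:C); last first.
  by apply/funext => n; rewrite rmorphXn.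
apply: seq_cvg_to_real; apply: cvg_expr.
rewrite ger0_norm -?ltcR//.
by rewrite -ler0c -zr.
Qed.

(** The [k]-th higher-order q-Euler polynomial, without its factor [(1 + Q)^r],
    in terms of the base [Q = q^c] and of [Y = q^(c y)]. *)
Definition qEuler_value (K : fieldType) (Q Y : K) (r k : nat) : K :=
  (1 - Q) ^- k * \sum_(l < k.+1) 'C(k, l)%:R * (- Y) ^+ l * (1 + Q ^+ l.+1) ^- r.
Arguments qEuler_value {K}.

(** After expanding the [k]-th power, each term is a geometric family of ratio
    [- Q^(l+1)] indexed by N^r. *)
Lemma has_sum_qEuler_value (R : realType) (Q Y : R[i]) (r k : nat) :
  `|Q| < 1 ->
  has_sum (fun m : {ffun 'I_r -> nat} => (- Q) ^+ (\sum_(l < r) m l)%N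
     * ((1 - Q ^+ (\sum_(l < r) m l)%N * Y) / (1 - Q)) ^+ k)
    (qEuler_value Q Y r k).
Proof.
move=> Q1.
have geo l : has_sum (fun m : {ffun 'I_r -> nat} =>
    (- Q ^+ l.+1) ^+ (\sum_(l < r) m l)%N) ((1 + Q ^+ l.+1) ^- r).
  have Ql : `|- Q ^+ l.+1| < 1 by rewrite normrN normrX exprn_ilt1.
  rewrite -[X in 1 + X]opprK; apply: has_sum_geometric => //.
  exact: seq_cvg_to_norm_expr0.
have := @has_sum_lincomb _ _ k.+1
  (fun l => (1 - Q) ^- k * ('C(k, l)%:R * (- Y) ^+ l)) _ _ (fun l _ => geo l).
congr has_sum; last first.
  by rewrite /qEuler_value mulr_sumr; apply: eq_bigr => l _; rewrite !mulrA.
apply/funext => m; set s := (\sum_(l < r) m l)%N.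
rewrite expr_div_n (exprDn 1 (- (Q ^+ s * Y))) mulr_suml mulr_sumr; apply: eq_bigr => l _.
rewrite expr1n mul1r -mulrN exprMn (exprNn Q) (exprNn (Q ^+ l.+1)) -!exprM.
by rewrite mulSn exprD (mulnC s l) -mulr_natr; ring.
Qed.

Lemma qEuler_genfun_unique (R : realType) (q lq : R[i]) (r c : nat) (y : R)
    (E E' : nat -> R[i]) :
  qEuler_genfun q lq r c y E -> qEuler_genfun q lq r c y E' ->
  forall n, E n = E' n.
Proof.
move=> hE hE' n.
have /(_ n)/eqP : forall n, (E n - E' n) / n`!%:R = 0.
  apply: power_series_eq0 => t.
  have [G sG EG] := hE t; have [G' sG' EG'] := hE' t.
  move: EG'; rewrite (has_sum_unique _ _ _ _ _ sG' sG) => EG'.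
  have := series_cvg_to_sub _ _ _ _ _ EG EG'; congr series_cvg_to.
  by apply/funext => j; rewrite mulrA mulrAC.
rewrite mulf_eq0 invr_eq0 pnatr_eq0 -leqn0 leqNgt fact_gt0 orbF subr_eq0.
by move/eqP.
Qed.

(** The closed form has the required generating function, hence by uniqueness
    it is the sequence selected by [xget], whose default value is not reached. *)
Lemma qEulerE (R : realType) (q lq : R[i]) (r c : nat) (y : R) (k : nat) :
  `|q| < 1 -> expC lq = q -> (0 < c)%N ->
  qEuler q lq r c y k = (1 + q ^+ c) ^+ r
    * qEuler_value (q ^+ c) (qpow lq (c%:R * y)) r k.
Proof.
move=> q1 hq c0; set Q := q ^+ c; set Y := qpow lq _.
have Q1 : `|Q| < 1 by rewrite normrX exprn_ilt1// -lt0n.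
have Qn1 : Q != 1 by apply: contraTneq Q1 => ->; rewrite normr1 ltxx.
(* A bound for all the q-numbers [|m| + y]_Q, since |Q| < 1. *)
pose W := complex.Re ((1 + `|Y|) / `|1 - Q|).
have WE : (1 + `|Y|) / `|1 - Q| = W%:C.
  by rewrite RRe_real// ger0_real// divr_ge0// addr_ge0.
pose rho := complex.Re `|Q|.
have rhoE : `|Q| = rho%:C by rewrite RRe_real// normr_real.
have HE : (1 - `|Q|) ^- r = ((1 - rho) ^- r)%:C.
  by rewrite rhoE fmorphV rmorphXn rmorphB.
have gen : qEuler_genfun q lq r c y
    (fun n => (1 + Q) ^+ r * qEuler_value Q Y r n).
  move=> t.
  have [||m|j|G sG EG] := has_sum_expC R _
    (fun m : {ffun 'I_r -> nat} => (- Q) ^+ (\sum_(l < r) m l)%N)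
    (fun m : {ffun 'I_r -> nat} =>
       (1 - Q ^+ (\sum_(l < r) m l)%N * Y) / (1 - Q))
    (qEuler_value Q Y r) ((1 - rho) ^- r) W t.
  - move=> A; rewrite -HE; under eq_bigr do rewrite normrX normrN.
    by rewrite sum_geometric_le.
  - by rewrite -ler0c -WE divr_ge0// addr_ge0.
  - rewrite -WE normrM normfV ler_wpM2r ?invr_ge0//.
    rewrite (le_trans (ler_normB _ _))// normr1 lerD2l normrM ler_piMl//.
    by rewrite normrX exprn_ile1// ltW.
  - exact: has_sum_qEuler_value.
  exists G.
    under eq_fun do rewrite (qnum_natD _ q)//.
    exact: sG.
  rewrite (qnum_two _ q _ _ hq Qn1).
  exact: (series_cvg_toZ R[i] ((1 + Q) ^+ r) (qEuler_value Q Y r)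
    (fun n => t ^+ n / n`!%:R) G EG).
apply: (qEuler_genfun_unique _ _ _ _ _ _ _ _ _ gen) => //.
exact: (xgetPex (fun=> 0) (ex_intro _ _ gen)).
Qed.

Theorem theorem3 (R : realType) (q lq : R[i])
    (hq0 : 0 < `|q|) (hq1 : `|q| < 1) (hlq : expC lq = q)
    (r : nat) (hr : (0 < r)%N) (x : R) (n a b : nat)
    (ha : a = 1 %[mod 2]) (hb : b = 1 %[mod 2]) :
  qnum q lq b 2 ^+ r *
    \sum_(0 <= i < n.+1)
       'C(n, i)%:R * qnum q lq 1 a%:R ^+ (n - i) * qnum q lq 1 b%:R ^+ i
       * qEuler q lq r a (b%:R * x) (n - i) * qS q lq r n i b a
  =
  qnum q lq a 2 ^+ r *
    \sum_(0 <= i < n.+1)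
       'C(n, i)%:R * qnum q lq 1 b%:R ^+ (n - i) * qnum q lq 1 a%:R ^+ i
       * qEuler q lq r b (a%:R * x) (n - i) * qS q lq r n i a b.
Proof.
have odd_of (m : nat) : m = 1 %[mod 2] -> odd m.
  by rewrite modn2 /=; case: (odd m).
have half (c d : nat) : odd c -> odd d ->
    qnum q lq d 2 ^+ r *
      \sum_(0 <= i < n.+1)
         'C(n, i)%:R * qnum q lq 1 c%:R ^+ (n - i) * qnum q lq 1 d%:R ^+ i
         * qEuler q lq r c (d%:R * x) (n - i) * qS q lq r n i d c
    = ((1 + q ^+ c) * (1 + q ^+ d)) ^+ r * (1 - q) ^- n *
      \sum_(l < n.+1) 'C(n, l)%:R * (- qpow lq (c%:R * d%:R * x)) ^+ l *
        ((1 + q ^+ (c * d * l.+1))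
         / ((1 + q ^+ (c * l.+1)) * (1 + q ^+ (d * l.+1)))) ^+ r.
  move=> oc od; have [c0 d0] := (odd_gt0 oc, odd_gt0 od).
  have qX m : (0 < m)%N -> `|q ^+ m| < 1.
    by move=> m0; rewrite normrX exprn_ilt1// -lt0n.
  have q_neq m : (0 < m)%N -> q ^+ m != 1.
    by move=> /qX; apply: contraTneq => ->; rewrite normr1 ltxx.
  rewrite (qnum_two _ q)// ?q_neq// !(qnum_nat _ q)// !mul1n expr1.
  apply: (binomial_qEuler_sum _ q (qpow lq (c%:R * d%:R * x)) r n c d
    (qEuler q lq r c (d%:R * x)) (fun i => qS q lq r n i d c)).
  - by [].
  - by rewrite -[q]expr1 q_neq.
  - by rewrite q_neq.
  - by rewrite q_neq.
  - move=> l; rewrite addrC -[1]opprK subr_eq0.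
    apply: contraTneq (qX (d * l.+1)%N _) => [->|]; last by rewrite muln_gt0 d0.
    by rewrite normrN normr1 ltxx.
  - move=> k; rewrite qEulerE// /qEuler_value -[RHS]mulrA; congr (_ * (_ * _)).
    by apply: eq_bigr => l _; rewrite mulrA exprM.
  - move=> i; rewrite /qS; apply: eq_bigr => j _.
    by rewrite (qnum_nat _ q).
rewrite !half ?odd_of// [(1 + q ^+ a) * _]mulrC [a%:R * b%:R]mulrC.
congr (_ * _); apply: eq_bigr => l _.
by rewrite [(a * b)%N]mulnC [X in _ / X]mulrC.
Qed.
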